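(* Let $n\ge 2$ be an integer, $\varepsilon\in(0,1]$, $\gamma>0$, and let $Q=2^q$ with $q\ge\max\{\log_2 n,\ \frac{4}{\gamma}\log_2\frac{3}{\varepsilon}\}$. Then with probability at least $3/4$, a random channel $W$ drawn from $\mathcal{W}_{Q,\varepsilon}$ satisfies $$\mathcal{R}^{(0)}_{W,n}\le 2q\left(1-\frac1n\right)(1+\gamma).$$ In particular, for $n=2$, $\mathcal{R}^{(0)}_{W,2}\le q(1+\gamma)$.
   Context: Fix an integer $q\ge1$, $Q=2^q$, $[Q]=\{1,\dots,Q\}$, and a symbol $\phi\notin[Q]$. A channel is a function $W=(W_1,W_2)$ with $W_i:[Q]^2\to\mathcal{O}$ for a finite output alphabet $\mathcal{O}$ (here $\mathcal{O}=[Q]\cup\{\phi\}$). For block length $n$, $W^{(n)}_i(x,y)=(W_i(x_1,y_1),\dots,W_i(x_n,y_n))$ for $x,y\in[Q]^n$. A code of block length $n$ with message sets $[M_1],[M_2]$ consists of encoders $E_i:[M_i]\to[Q]^n$ and decoders $D_i:\mathcal{O}^n\to[M_i]$; it succeeds on $(m_1,m_2)$ if $D_i(W^{(n)}_i(E_1(m_1),E_2(m_2)))=m_i$ for $i=1,2$. A rate pair $(R_1,R_2)$ is achievable with probability $1-\varepsilon$ and block length $n$ if, with $M_i=2^{R_in}$ (positive integers), some code succeeds with probability at least $1-\varepsilon$ for $(m_1,m_2)$ uniform on $[M_1]\times[M_2]$; $\mathcal{R}^{(\varepsilon)}_{W,n}$ is the supremum of $R_1+R_2$ over such pairs, $\mathcal{R}^{(\varepsilon)}_W=\sup_n\mathcal{R}^{(\varepsilon)}_{W,n}$;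 $\varepsilon=0$ means success on every message pair. $\mathcal{W}_{Q,\varepsilon}$ is the distribution over channels $W:[Q]^2\to([Q]\cup\{\phi\})^2$ in which, independently for every $(x,y)\in[Q]^2$, $W(x,y)=(\phi,\phi)$ with probability $\varepsilon$ and $W(x,y)=(x,y)$ otherwise. Logarithms are base 2. *)

(* Defs.v *)
From Stdlib Require Import Reals ClassicalEpsilon.
From mathcomp Require Import all_boot.
Set Implicit Arguments. Unset Strict Implicit. Unset Printing Implicit Defensive.

Open Scope R_scope.

Definition log2 (x : R) : R := ln x / ln 2.

Definition chan (Q : nat) (O : Type) : Type :=
  (('I_Q -> 'I_Q -> O) * ('I_Q -> 'I_Q -> O))%type.

Definition succeeds_all (Q n : nat) (O : Type) (W : chan Q O) (M1 M2 : nat)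
  (E1 : 'I_M1 -> 'I_n -> 'I_Q) (E2 : 'I_M2 -> 'I_n -> 'I_Q)
  (D1 : ('I_n -> O) -> 'I_M1) (D2 : ('I_n -> O) -> 'I_M2) : Prop :=
  forall (m1 : 'I_M1) (m2 : 'I_M2),
    D1 (fun k => W.1 (E1 m1 k) (E2 m2 k)) = m1 /\
    D2 (fun k => W.2 (E1 m1 k) (E2 m2 k)) = m2.

Definition achievable0 (Q : nat) (O : Type) (n : nat) (W : chan Q O) (R1 R2 : R) : Prop :=
  exists M1 M2 : nat,
    (0 < M1)%N /\ (0 < M2)%N /\
    INR M1 = Rpower 2 (R1 * INR n) /\ INR M2 = Rpower 2 (R2 * INR n) /\
    exists E1 E2 D1 D2, @succeeds_all Q n O W M1 M2 E1 E2 D1 D2.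

(** The channel with erasure set E: W(x,y) = (phi,phi) if (x,y) \in E, else (x,y).
    Output alphabet [Q] ∪ {phi} is option 'I_Q with phi = None. *)
Definition erasure_chan (Q : nat) (E : {set ('I_Q * 'I_Q)}) : chan Q (option 'I_Q) :=
  (fun x y => if (x, y) \in E then None else Some x,
   fun x y => if (x, y) \in E then None else Some y).

(** Probability of erasure pattern E under W_{Q,eps}: each of the Q^2 input
    pairs erased independently with probability eps. *)
Definition pattern_weight (Q : nat) (eps : R) (E : {set ('I_Q * 'I_Q)}) : R :=
  eps ^ #|E| * (1 - eps) ^ (Q * Q - #|E|)%N.

Definition prob_W (Q : nat) (eps : R) (P : chan Q (option 'I_Q) -> Prop) : R :=
  \big[Rplus/0]_(E : {set ('I_Q * 'I_Q)})
     (if excluded_middle_informative (P (erasure_chan E))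
      then @pattern_weight Q eps E else 0).

(* Main.v *)
Require Import Defs.
From Stdlib Require Import Reals Lra ClassicalEpsilon.
From mathcomp Require Import all_boot zify Rstruct.
From Coquelicot Require Rcomplements.
Open Scope R_scope.

(** Let [K] be the integer part of [4 Q / eps].  A union bound over the [4 ^ Q]
    rectangles shows that with probability at least [3/4] every erasure-free
    rectangle [A x B] of inputs has [|A| |B| <= K].  For such a channel, take a
    zero-error code and two coordinates [k <> l].  If [S] is the largest set of
    codewords of user 1 differing only in coordinate [k], no symbol used by
    user 2 in coordinate [k] is erased against two elements of [S]; halving [S]
    then gives [|S| |T| <= 6 K], where [T] is the [k]-projection of user 2's
    code.  Symmetrically for user 2 and [l].  Since [M1] is at most
    [|S| Q^(n-2)] times the size of the [l]-projection of user 1's code, and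
    likewise for [M2], multiplying the two estimates yields
    [M1 M2 <= (6 K Q^(n-2))^2]. *)

(** * Erasure-free rectangles and the size of zero-error codes *)

Lemma subset_of_card (X : finType) (S : {set X}) (h : nat) :
  (h <= #|S|)%N -> exists2 S' : {set X}, S' \subset S & #|S'| = h.
Proof.
move=> hS; exists [set x in take h (enum S)].
  by apply/subsetP=> x; rewrite inE => /mem_take; rewrite mem_enum.
rewrite cardsE (card_uniqP _) ?take_uniq ?enum_uniq //.
by rewrite size_take -cardE; case: ltngtP hS.
Qed.

Lemma rect_card_le (X Y : finType) (r : X -> Y -> bool) (K : nat)
    (S : {set X}) (T : {set Y}) :
  (#|Y| <= 6 * K)%N ->
  (forall (A : {set X}) (B : {set Y}),
      {in A & B, forall x y, ~~ r x y} -> (#|A| * #|B| <= K)%N) ->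
  (forall x x' y, x \in S -> x' \in S -> y \in T -> r x y -> r x' y -> x = x') ->
  (#|S| * #|T| <= 6 * K)%N.
Proof.
move=> YK empK rinj.
(* If [S] has at most one element, its lower half is empty and says nothing about [T]; the
   hypothesis on [#|Y|] settles this case. *)
case: (leqP #|S| 1) => [S1 | S2].
  have TY : (#|T| <= #|Y|)%N by apply: max_card.
  by apply: leq_trans (leq_trans TY YK); rewrite -[leqRHS]mul1n leq_mul2r S1 orbT.
(* Each column has at most one marked row in S, so it misses one of the two halves of S. *)
have [|S' S'S cS'] := @subset_of_card _ S (#|S|./2); first by lia.
pose B (A : {set X}) := [set y in T | [forall x in A, ~~ r x y]].
have bound (A : {set X}) : (#|A| * #|B A| <= K)%N.
  apply: empK => x y xA; rewrite inE => /andP[_ /forall_inP]; exact.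
have TB : T \subset B S' :|: B (S :\: S').
  apply/subsetP=> y yT; rewrite !inE yT /=.
  case: (boolP [forall x in S', ~~ r x y]) => //=.
  case/forall_inPn=> x xS' /negPn rxy.
  apply/forall_inP=> x'; rewrite inE => /andP[x'S' x'S]; apply/negP=> rx'y.
  by case/negP: x'S'; rewrite -(rinj x x' y) // (subsetP S'S).
have h3 := leq_trans (subset_leq_card TB) (leq_card_setU _ _).
have h1 := bound S'; have h2 := bound (S :\: S').
rewrite cardsDS // cS' in h1 h2.
have {}h2 : (#|S|./2 * #|B (S :\: S')| <= K)%N.
  by apply: leq_trans h2; rewrite leq_mul2r; lia.
(* The constant is 6 = 3 * 2: [#|S|] is at least 2, so at most three times its rounded-down half
   (tight at 3), and [T] is covered by two sets. *)
have h4 : (#|S| <= 3 * #|S|./2)%N by lia.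
by apply: leq_trans (leq_mul h4 h3) _; nia.
Qed.

(** The axis-parallel line through [c i0] in direction [k], pulled back to indices so that messages
    sharing a codeword are counted separately. *)
Definition line {I T : finType} {n : nat} (c : I -> 'I_n -> T) (k : 'I_n) (i0 : I) :
  {set I} := [set i | [forall j, (j != k) ==> (c i j == c i0 j)]].

(** Overwriting coordinate [k] by a fixed symbol is a map whose fibres lie in lines. Its image lies
    in a box: one value at [k], the projection at [l], any symbol at the remaining [n - 2]
    coordinates. *)
Lemma card_code_le (I T : finType) (n s : nat) (c : I -> 'I_n -> T) (k l : 'I_n) :
  k != l -> (forall i0, #|line c k i0| <= s)%N ->
  (#|I| <= s * (#|[set c i l | i : I]| * #|T| ^ (n - 2)))%N.
Proof.
move=> kl hs.
case: (pickP (mem I)) => [i0 _ | I0]; last by rewrite (eq_card0 I0).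
pose h i : {ffun 'I_n -> T} := [ffun j => if j == k then c i0 k else c i j].
pose F j : pred T := if j == k then pred1 (c i0 k)
  else if j == l then [pred x in [set c i l | i : I]] else predT.
have -> : #|I| = (\sum_(f in h @: I) \sum_(i in I | h i == f) 1)%N.
  by rewrite -sum1_card (partition_big_imset h).
apply: (@leq_trans (\sum_(f in h @: I) s)).
  apply: leq_sum => f /imsetP[i1 _ ->]; apply: leq_trans (hs i1).
  rewrite sum1_card; apply: subset_leq_card; apply/subsetP=> i.
  move=> hi; have {}hi : h i = h i1 by apply/eqP; exact: hi.
  rewrite inE; apply/forallP=> j.
  apply/implyP=> /negbTE jk; move/ffunP: hi => /(_ j).
  by rewrite !ffunE jk => /eqP.
rewrite sum_nat_const mulnC leq_mul2l; apply/orP; right.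
have hF : h @: I \subset family F.
  apply/subsetP=> f /imsetP[i _ ->]; apply/familyP=> j; rewrite ffunE /F.
  case: (j == k); first exact: eqxx.
  by case: eqP => [->|//]; apply: imset_f.
apply: leq_trans (subset_leq_card hF) _.
rewrite card_family foldrE big_map big_enum /= (bigD1 k) //= (bigD1 l) 1?eq_sym //=.
rewrite (eq_bigr (fun=> #|T|)); last first.
  by move=> j /andP[/negbTE jk /negbTE jl]; rewrite /F jk jl; apply: eq_card.
have -> : #|F k| = 1%N by rewrite /F eqxx card1.
have -> : #|F l| = #|[set c i l | i : I]|.
  by rewrite /F eq_sym (negbTE kl) eqxx; apply: eq_card.
rewrite prod_nat_const mul1n leq_mul2l; apply/orP; right.
suff -> : #|(fun j => (j != k) && (j != l))| = (n - 2)%N by [].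
have -> : #|(fun j => (j != k) && (j != l))| = #|~: [set k; l]|.
  by apply: eq_card => j; rewrite !inE negb_or.
by have := cardsC [set k; l]; rewrite cards2 kl card_ord; lia.
Qed.

(* Two messages of user 1 on a common [k]-line, both erased against the [k]-th
   symbol of some codeword of user 2, would be confused by receiver 1. *)
Lemma line_proj_le (Q n K M1 M2 : nat) (r : 'I_Q -> 'I_Q -> bool)
    (c1 : 'I_M1 -> 'I_n -> 'I_Q) (c2 : 'I_M2 -> 'I_n -> 'I_Q)
    (D : ('I_n -> option 'I_Q) -> 'I_M1) (k : 'I_n) (i0 : 'I_M1) :
  (0 < M2)%N -> (Q <= 6 * K)%N ->
  (forall A B : {set 'I_Q},
      {in A & B, forall x y, ~~ r x y} -> (#|A| * #|B| <= K)%N) ->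
  (forall m1 m2, D (fun k => if r (c1 m1 k) (c2 m2 k) then None
                             else Some (c1 m1 k)) = m1) ->
  (#|line c1 k i0| * #|[set c2 m k | m : 'I_M2]| <= 6 * K)%N.
Proof.
move=> M2pos QK empK hD.
have agree m m' : m \in line c1 k i0 -> m' \in line c1 k i0 ->
    forall j, j != k -> c1 m j = c1 m' j.
  rewrite !inE => /forallP h /forallP h' j jk.
  by move: (h j) (h' j); rewrite jk /= => /eqP-> /eqP->.
have extD m m' m2 :
  (forall j, (if r (c1 m j) (c2 m2 j) then None else Some (c1 m j)) =
     (if r (c1 m' j) (c2 m2 j) then None else Some (c1 m' j))) -> m = m'.
  move=> e; rewrite -(hD m m2) -(hD m' m2); congr D.
  exact: FunctionalExtensionality.functional_extensionality.
(* Lines are sets of messages, whereas rectangles consist of symbols. Two messages on the line that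
   also agree at [k] have equal codewords, so they are decoded alike. *)
have inj : {in line c1 k i0 &, injective (fun m => c1 m k)}.
  move=> m m' hm hm' /= e; apply: (extD _ _ (Ordinal M2pos)) => j.
  by case: (eqVneq j k) => [->|/(agree m m' hm hm') ->]; rewrite ?e.
rewrite -(card_in_imset inj).
apply: (@rect_card_le _ _ r) => //; first by rewrite card_ord.
move=> _ _ _ /imsetP[m hm ->] /imsetP[m' hm' ->] /imsetP[m2 _ ->] e e'.
congr c1; apply: (extD _ _ m2) => j.
by case: (eqVneq j k) => [->|/(agree m m' hm hm') ->]; rewrite ?e ?e'.
Qed.

Lemma code_size_le (Q n K M1 M2 : nat) (E : {set 'I_Q * 'I_Q}) E1 E2 D1 D2 :
  (2 <= n)%N -> (Q <= 6 * K)%N ->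
  (forall A B : {set 'I_Q}, [disjoint setX A B & E] -> (#|A| * #|B| <= K)%N) ->
  @succeeds_all Q n (option 'I_Q) (erasure_chan E) M1 M2 E1 E2 D1 D2 ->
  (M1 * M2 <= (6 * K * Q ^ (n - 2)) ^ 2)%N.
Proof.
move=> n2 QK empK code.
case: (posnP M1) => [->|M1pos]; first by rewrite mul0n.
case: (posnP M2) => [->|M2pos]; first by rewrite muln0.
pose k := Ordinal (ltnW n2); pose l : 'I_n := Ordinal n2.
have kl : k != l by [].
have empr (A B : {set 'I_Q}) :
    {in A & B, forall x y, (x, y) \notin E} -> (#|A| * #|B| <= K)%N.
  move=> h; apply: empK; rewrite disjoint_subset; apply/subsetP=> -[x y].
  by rewrite in_setX => /andP[xA yB]; rewrite inE; apply: h.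
have [i1 hi1] : {i | \max_i #|line E1 k i| = #|line E1 k i|}.
  by apply: eq_bigmax; rewrite card_ord.
have [i2 hi2] : {i | \max_i #|line E2 l i| = #|line E2 l i|}.
  by apply: eq_bigmax; rewrite card_ord.
have b1 := line_proj_le Q n K M1 M2 (fun x y => (x, y) \in E) E1 E2 D1 k i1 M2pos QK
  empr (fun m1 m2 => proj1 (code m1 m2)).
(* User 2 sees the transposed erasure relation. *)
have b2' := line_proj_le Q n K M2 M1 (fun y x => (x, y) \in E) E2 E1 D2 l i2 M1pos QK.
have b2 : (#|line E2 l i2| * #|[set E1 m l | m : 'I_M1]| <= 6 * K)%N.
  apply: b2' => [A B h | m2 m1]; last exact: (proj2 (code m1 m2)).
  by rewrite mulnC; apply: empr => x y xB yA; apply: h.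
pose p1 := #|[set E1 m l | m : 'I_M1]|; pose p2 := #|[set E2 m k | m : 'I_M2]|.
rewrite -/p2 in b1; rewrite -/p1 in b2; set x := (Q ^ (n - 2))%N.
have c1 : (M1 <= #|line E1 k i1| * (p1 * x))%N.
  have := card_code_le _ _ _ #|line E1 k i1| E1 k l kl.
  by rewrite !card_ord; apply=> i; rewrite -hi1; apply: leq_bigmax.
have c2 : (M2 <= #|line E2 l i2| * (p2 * x))%N.
  have := card_code_le _ _ _ #|line E2 l i2| E2 l k kl.
  by rewrite !card_ord; apply=> i; rewrite -hi2; apply: leq_bigmax.
(* Regroup the factors crosswise: the line of each user is paired with the projection of the other,
   as in [b1] and [b2]. *)
apply: leq_trans (leq_mul c1 c2) _.
have := leq_mul (leq_mul b1 b2) (leqnn (x * x)%N).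
nia.
Qed.

(** * The erasure distribution and the union bound *)

Lemma INR_muln (a b : nat) : INR (a * b)%N = INR a * INR b.
Proof. by rewrite -multE mult_INR. Qed.

Lemma INR_expn2 (m : nat) : INR (2 ^ m)%N = 2 ^ m.
Proof. by elim: m => //= m IH; rewrite expnS INR_muln IH. Qed.

Lemma bigR_le (I : finType) (P : pred I) (F G : I -> R) :
  (forall i, P i -> F i <= G i) ->
  \big[Rplus/0]_(i | P i) F i <= \big[Rplus/0]_(i | P i) G i.
Proof.
move=> FG; elim/big_rec2: _ => [|i x y Pi xy]; first exact: Rle_refl.
by apply: Rplus_le_compat => //; apply: FG.
Qed.

Lemma bigR_const (I : finType) (x : R) :
  \big[Rplus/0]_(i : I) x = INR #|I| * x.
Proof.
rewrite big_const; elim: #|I| => [|m IH]; first by rewrite /= Rmult_0_l.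
by rewrite iterS IH S_INR; ring.
Qed.

Lemma bigR_prod_const (I : finType) (A : {set I}) (x : R) :
  \big[Rmult/1]_(i in A) x = x ^ #|A|.
Proof. by rewrite big_const; elim: #|A| => //= m ->. Qed.

Lemma pattern_weight_prod (Q : nat) (eps : R) (E : {set 'I_Q * 'I_Q}) :
  pattern_weight eps E =
  \big[Rmult/1]_(z : 'I_Q * 'I_Q) (if z \in E then eps else 1 - eps).
Proof.
rewrite /pattern_weight (bigID (mem E)) /=.
rewrite (eq_bigr (fun=> eps)) ?bigR_prod_const; last by move=> z ->.
rewrite (eq_big (mem (~: E)) (fun=> 1 - eps)); last first.
- by move=> z /negbTE ->.
- by move=> z; rewrite !inE.
by rewrite bigR_prod_const (cardsCs (~: E)) setCK card_prod card_ord.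
Qed.

Lemma pattern_weight_ge0 (Q : nat) (eps : R) (E : {set 'I_Q * 'I_Q}) :
  0 <= eps <= 1 -> 0 <= pattern_weight eps E.
Proof. by move=> heps; apply: Rmult_le_pos; apply: pow_le; lra. Qed.

(** Expand the product by distributivity, choosing at each input pair between erased and kept.
    Giving erasure the weight 0 on [D] kills exactly the terms of the patterns that meet [D]. *)
Lemma pattern_weight_avoid (Q : nat) (eps : R) (D : {set 'I_Q * 'I_Q}) :
  \big[Rplus/0]_(E : {set 'I_Q * 'I_Q} | [disjoint D & E]) pattern_weight eps E
  = (1 - eps) ^ #|D|.
Proof.
transitivity (\big[Rmult/1]_(z : 'I_Q * 'I_Q)
    ((if z \in D then 0 else eps) + (1 - eps))).
  rewrite (@bigA_distr _ _ _ Rmult Rplus) big_mkcond /=; apply: eq_bigr => E _.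
  case: ifP => [DE|/negbT/pred0Pn[z /andP[/= zD zE]]]; last first.
    by rewrite (bigD1 z) //= zE zD Rmult_0_l.
  rewrite pattern_weight_prod; apply: eq_bigr => z _.
  by case: ifP => // zE; rewrite (disjointFl DE zE).
rewrite (bigID (mem D)) /=.
rewrite (eq_bigr (fun=> 1 - eps)) ?bigR_prod_const; last by move=> z ->; ring.
rewrite [X in _ * X](eq_bigr (fun=> 1)); last by move=> z /negbTE ->; ring.
by rewrite [X in _ * X]big1 // Rmult_1_r.
Qed.

Lemma pattern_weight_total (Q : nat) (eps : R) :
  \big[Rplus/0]_(E : {set 'I_Q * 'I_Q}) pattern_weight eps E = 1.
Proof.
transitivity ((1 - eps) ^ #|set0 : {set 'I_Q * 'I_Q}|); last by rewrite cards0.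
rewrite -pattern_weight_avoid; apply: eq_bigl => E.
by rewrite disjoints_subset sub0set.
Qed.

Lemma exp_mul_INR (x : R) (m : nat) : exp (x * INR m) = exp x ^ m.
Proof.
by rewrite -Rpower_pow; [rewrite /Rpower ln_exp Rmult_comm | apply: exp_pos].
Qed.

(** Use [1 - eps <= exp (- eps)] and [exp 1 >= 2]. The base 16 is chosen to beat the [4 ^ Q]
    rectangles of the union bound, leaving [(1 / 4) ^ Q]. *)
Lemma pow_erase_le (Q m : nat) (eps : R) :
  0 < eps <= 1 -> 4 * INR Q / eps < INR m -> (1 - eps) ^ m <= / 16 ^ Q.
Proof.
move=> heps hm.
have h1 : (1 - eps) ^ m <= exp (- eps) ^ m.
  by apply: pow_incr; have := exp_ineq1_le (- eps); lra.
apply: Rle_trans h1 _.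
rewrite -exp_mul_INR.
have i4 : INR 4 = 4 by simpl; lra.
have e4 : exp (- INR 4) <= / 16.
  rewrite exp_Ropp; apply: Rinv_le_contravar; first lra.
  rewrite -(Rmult_1_l (INR 4)) exp_mul_INR.
  apply: (Rle_trans _ (2 ^ 4)); first by simpl; lra.
  by apply: pow_incr; have := exp_ineq1_le 1; lra.
apply: (Rle_trans _ (exp (- INR 4) ^ Q)).
  rewrite -exp_mul_INR.
  have : - eps * INR m <= - INR 4 * INR Q.
    have := Rmult_lt_compat_l eps _ _ (proj1 heps) hm.
    have -> : eps * (4 * INR Q / eps) = 4 * INR Q by field; lra.
    rewrite i4; lra.
  case=> [/exp_increasing /Rlt_le | ->] //; exact: Rle_refl.
rewrite -pow_inv; apply: pow_incr; split=> //; exact/Rlt_le/exp_pos.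
Qed.

Lemma prob_W_ge (Q K : nat) (eps : R) (P : chan Q (option 'I_Q) -> Prop) :
  (0 < Q)%N -> 0 < eps <= 1 -> 4 * INR Q / eps < INR K + 1 ->
  (forall E : {set 'I_Q * 'I_Q},
     (forall A B : {set 'I_Q}, [disjoint setX A B & E] -> (#|A| * #|B| <= K)%N) ->
     P (erasure_chan E)) ->
  3 / 4 <= prob_W eps P.
Proof.
move=> Q0 heps hK goodP.
pose bad (AB : {set 'I_Q} * {set 'I_Q}) (E : {set 'I_Q * 'I_Q}) :=
  (K < #|AB.1| * #|AB.2|)%N && [disjoint setX AB.1 AB.2 & E].
pose w E := pattern_weight (Q := Q) eps E.
have w0 E : 0 <= w E by apply: pattern_weight_ge0; lra.
(* The union bound, stated weight by weight: a pattern violating [P] is charged to at least one bad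
   rectangle. *)
have pointwise E : w E <=
   (if excluded_middle_informative (P (erasure_chan E)) then w E else 0) +
   \big[Rplus/0]_AB (if bad AB E then w E else 0).
  have s0 p : 0 <= \big[Rplus/0]_(AB | p AB) (if bad AB E then w E else 0).
    elim/big_rec: _ => [|AB x _ x0]; first exact: Rle_refl.
    by case: ifP => _; have := w0 E; lra.
  case: excluded_middle_informative => [h|nP] /=; first by have /= := s0 xpredT; lra.
  case: (pickP (bad^~ E)) => [AB hAB | good].
    rewrite (bigD1 AB) //= hAB Rplus_0_l -{1}(Rplus_0_r (w E)).
    by apply: Rplus_le_compat_l; apply: s0.
  case: nP; apply: goodP => A B AB; have := good (A, B).
  by rewrite /bad /= AB andbT; case: ltnP.
have union : \big[Rplus/0]_E \big[Rplus/0]_AB (if bad AB E then w E else 0) <= 1 / 4.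
  rewrite exchange_big /=.
  apply: (Rle_trans _ (\big[Rplus/0]_(AB : {set 'I_Q} * {set 'I_Q}) (/ 16 ^ Q))).
    apply: bigR_le => -[A B] _; rewrite -big_mkcond /bad /=.
    case: (ltnP K) => KAB /=; last first.
      rewrite big_pred0_eq; apply: Rlt_le; apply: Rinv_0_lt_compat; apply: pow_lt; lra.
    rewrite pattern_weight_avoid; apply: pow_erase_le => //.
    (* An area above [K] is at least [K + 1], hence exceeds [4 Q / eps]. *)
    rewrite cardsX -multE; apply: Rlt_le_trans hK _.
    by rewrite -S_INR; apply: le_INR; apply/leP.
  rewrite bigR_const card_prod -cardsT -powersetT card_powerset cardsT card_ord.
  have -> : INR (2 ^ Q * 2 ^ Q) = 4 ^ Q.
    by rewrite INR_muln INR_expn2 -Rpow_mult_distr; congr (_ ^ _); ring.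
  have -> : 4 ^ Q * / 16 ^ Q = (1 / 4) ^ Q.
    by rewrite -pow_inv -Rpow_mult_distr; congr (_ ^ _); field.
  move: Q0; clear; case: Q => // q' _ /=.
  have h : (1 / 4) ^ q' <= 1 ^ q' by apply: pow_incr; lra.
  by rewrite pow1 in h; lra.
have := bigR_le _ xpredT _ _ (fun E _ => pointwise E).
rewrite big_split /= pattern_weight_total => h.
apply: (Rplus_le_reg_r (1 / 4)); have -> : 3 / 4 + 1 / 4 = 1 by field.
by apply: Rle_trans h _; apply: Rplus_le_compat_l.
Qed.

(** * From code size to rates *)

Lemma log2K (x : R) : 0 < x -> Rpower 2 (log2 x) = x.
Proof.
move=> x0; rewrite /Rpower /log2; have -> : ln x / ln 2 * ln 2 = ln x.
  by field; have := ln_lt_2; lra.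
exact: exp_ln.
Qed.

Lemma Rpower_le_exponent (x y : R) : Rpower 2 x <= Rpower 2 y -> x <= y.
Proof.
move=> xy; case: (Rle_or_lt x y) => // yx.
by have := Rpower_lt 2 y x ltac:(lra) yx; lra.
Qed.

Lemma INR_expn2_Rpower (m : nat) : INR (2 ^ m)%N = Rpower 2 (INR m).
Proof. by rewrite INR_expn2 Rpower_pow //; lra. Qed.

Lemma rate_sum_le (n q K M1 M2 : nat) (eps gamma R1 R2 : R) :
  (2 <= n)%N -> 0 < eps <= 1 -> 0 < gamma ->
  4 / gamma * log2 (3 / eps) <= INR q ->
  INR K <= 4 * INR (2 ^ q)%N / eps ->
  (M1 * M2 <= (6 * K * (2 ^ q) ^ (n - 2)) ^ 2)%N ->
  INR M1 = Rpower 2 (R1 * INR n) -> INR M2 = Rpower 2 (R2 * INR n) ->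
  R1 + R2 <= 2 * INR q * (1 - 1 / INR n) * (1 + gamma).
Proof.
move=> n2 heps hgamma hq hK hM h1 h2.
have n2R : 2 <= INR n by apply: (le_INR 2); apply/leP.
have q0 := pos_INR q.
have eps3 : 3 <= 3 / eps.
  by apply: (Rmult_le_reg_r eps); [lra | rewrite /Rdiv Rmult_assoc Rinv_l; lra].
have hgq : 4 * log2 (3 / eps) <= INR q * gamma.
  have -> : 4 * log2 (3 / eps) = 4 / gamma * log2 (3 / eps) * gamma by field; lra.
  by apply: Rmult_le_compat_r; lra.
(* Here 24 = 6 * 4, from [6 * K] and [K <= 4 Q / eps]. With [x = 3 / eps >= 3], one has
   [8 x <= x ^ 4], which explains the factor 4 in the assumption on [q]. *)
have eps4 : 24 / eps <= Rpower 2 (INR q * gamma).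
  apply: (Rle_trans _ (Rpower 2 (4 * log2 (3 / eps)))); last by apply: Rle_Rpower; lra.
  rewrite Rmult_comm -Rpower_mult log2K; last lra.
  have -> : 4 = INR 4 by simpl; lra.
  rewrite Rpower_pow; last lra.
  have -> : 24 / eps = 8 * (3 / eps) by field; lra.
  move: (3 / eps) eps3 => x x3; have : 27 <= x * x * x by nra.
  by rewrite /=; nra.
have hK6 : INR (6 * K)%N <= Rpower 2 (INR q + INR q * gamma).
  rewrite INR_muln Rpower_plus -INR_expn2_Rpower.
  have -> : INR 6 = 6 by simpl; lra.
  have Q0 := pos_INR (2 ^ q)%N.
  have := Rmult_le_compat_l _ _ _ Q0 eps4.
  move: hK; rewrite /Rdiv; lra.
apply: (Rmult_le_reg_r (INR n)); first lra.
(* The exponent given by the size bound falls short of the target by [2 q gamma (n - 2)], which is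
   nonnegative. *)
apply: (Rle_trans _ (2 * (INR q + INR q * gamma + INR q * (INR n - 2)))); last first.
  have -> : 2 * INR q * (1 - 1 / INR n) * (1 + gamma) * INR n
          = 2 * INR q * (INR n - 1) * (1 + gamma) by field; lra.
  have : 0 <= INR q * gamma * (INR n - 2).
    by apply: Rmult_le_pos; [apply: Rmult_le_pos|]; lra.
  lra.
apply: Rpower_le_exponent.
rewrite Rmult_plus_distr_r Rpower_plus -h1 -h2 -INR_muln.
apply: (Rle_trans _ (INR ((6 * K * (2 ^ q) ^ (n - 2)) ^ 2)%N)).
  by apply: le_INR; apply/leP.
rewrite -mulnn INR_muln (INR_muln (6 * K)) -expnM INR_expn2_Rpower (INR_muln q).
rewrite -minusE minus_INR; last exact/leP.
have -> : INR 2 = 2 by [].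
have -> x : 2 * x = x + x by ring.
rewrite Rpower_plus (Rpower_plus (INR q + INR q * gamma)).
have p0 := exp_pos (INR q * (INR n - 2) * ln 2).
have k0 := pos_INR (6 * K)%N.
by apply: Rmult_le_compat; try (apply: Rmult_le_pos => //; exact: Rlt_le);
  apply: Rmult_le_compat_r => //; exact: Rlt_le.
Qed.

Theorem theorem1 (n q : nat) (eps gamma : R) :
  (2 <= n)%N -> (1 <= q)%N ->
  0 < eps <= 1 -> 0 < gamma ->
  INR q >= Rmax (log2 (INR n)) (4 / gamma * log2 (3 / eps)) ->
  @prob_W (2 ^ q)%N eps
    (fun W => forall R1 R2 : R, @achievable0 (2 ^ q)%N (option 'I_(2 ^ q)) n W R1 R2 ->
        R1 + R2 <= 2 * INR q * (1 - 1 / INR n) * (1 + gamma))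
  >= 3 / 4.
Proof.
move=> n2 q1 heps hgamma hq.
have Q0 : (0 < 2 ^ q)%N by rewrite expn_gt0.
have Q1 : 1 <= INR (2 ^ q)%N by apply: (le_INR 1); apply/leP.
have hx : 4 * INR (2 ^ q)%N <= 4 * INR (2 ^ q)%N / eps.
  apply: (Rmult_le_reg_r eps); first lra.
  by rewrite /Rdiv (Rmult_assoc _ (/ eps)) Rinv_l; nra.
(* [K] is the floor: its upper bound serves the rate estimate, and the lower bound on [K + 1] serves
   the probability estimate. *)
have [|K [K1 K2]] := Rcomplements.nfloor_ex (4 * INR (2 ^ q)%N / eps); first lra.
have QK : (2 ^ q <= 6 * K)%N.
  suff : (2 ^ q <= K)%N by lia.
  by apply/leP; apply: INR_le; lra.
apply: Rle_ge; apply: (@prob_W_ge _ K) => // E goodE R1 R2.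
move=> [M1 [M2 [_ [_ [h1 [h2 [E1 [E2 [D1 [D2 code]]]]]]]]]].
apply: (@rate_sum_le n q K M1 M2 eps) => //.
  by apply: Rle_trans (Rge_le _ _ hq); apply: Rmax_r.
exact: (@code_size_le _ _ _ _ _ E E1 E2 D1 D2).
Qed.
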